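(* Let $X$ be a real random variable with the hyperbolic secant distribution, i.e. with density $$f(x)=\frac{1}{\pi\cosh(x)}=\frac{2}{\pi\,(e^{x}+e^{-x})},\qquad x\in\mathbb{R}.$$ Let $\delta\in\mathbb{R}$, $\delta\neq0$, and put $$\theta:=\frac{2}{(e^{-\delta}+e^{\delta})^2}.$$ Then the density $f_\delta$ of $|X+\delta|$ can be written as $$f_\delta(x)=\sum_{k=0}^\infty w_\theta(k)\,g_k(x)\qquad\text{for all } x>0,$$ where, for all $k\in\mathbb{N}_0$ and $x>0$, $$w_\theta(k)=\frac{\binom{2k}{k}}{2^{2k}}\,(1-\theta)^k\,\theta^{1/2},$$ $$g_k(x)=\frac{2^{2k+3/2}}{\pi\binom{2k}{k}}\;\frac{e^{x}+e^{-x}}{e^{2x}+e^{-2x}}\left(\frac{(e^{x}-e^{-x})^2}{e^{2x}+e^{-2x}}\right)^{k}.$$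
   Context: $\mathbb{N}_0=\{0,1,2,\ldots\}$. Densities are with respect to Lebesgue measure; $f_\delta$ denotes the continuous version on $(0,\infty)$ of the density of $|X+\delta|$. *)

(* Defs.v *)
From HB Require Import structures.
From mathcomp Require Import all_boot all_order all_algebra.
From mathcomp Require Import all_classical all_reals all_analysis.

Set Implicit Arguments.
Unset Strict Implicit.
Unset Printing Implicit Defensive.

Import Order.TTheory GRing.Theory Num.Theory.
Import numFieldNormedType.Exports.

Local Open Scope classical_set_scope.
Local Open Scope ring_scope.

Definition has_density d (T : measurableType d) (R : realType)
    (P : probability T R) (Y : T -> R) (f : R -> R) : Prop :=
  [/\ measurable_fun [set: R] f,
      (forall x, 0 <= f x) &
      forall A : set R, measurable A ->
        P (Y @^-1` A) = (\int[lebesgue_measure]_(x in A) (f x)%:E)%E].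

(* Such an f is determined on (0, +oo) only; its values on (-oo, 0] are
   constrained just by has_density, i.e. up to a null set. *)
Definition has_density_continuous_gt0 d (T : measurableType d) (R : realType)
    (P : probability T R) (Y : T -> R) (f : R -> R) : Prop :=
  has_density P Y f /\ (forall x, 0 < x -> {for x, continuous f}).

Definition sech_pdf (R : realType) (x : R) : R :=
  2 / (pi * (expR x + expR (- x))).

Definition sech_theta (R : realType) (delta : R) : R :=
  2 / (expR (- delta) + expR delta) ^+ 2.

Definition mix_weight (R : realType) (theta : R) (k : nat) : R :=
  'C(2 * k, k)%:R / 2 ^+ (2 * k) * (1 - theta) ^+ k * theta `^ (1 / 2).

Definition mix_density (R : realType) (k : nat) (x : R) : R :=
  2 `^ ((2 * k)%:R + 3 / 2) / (pi * 'C(2 * k, k)%:R)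
  * ((expR x + expR (- x)) / (expR (2 * x) + expR (- (2 * x))))
  * ((expR x - expR (- x)) ^+ 2 / (expR (2 * x) + expR (- (2 * x)))) ^+ k.

(* Main.v *)
Require Import Defs.
From HB Require Import structures.
From mathcomp Require Import all_boot all_order all_algebra.
From mathcomp Require Import all_classical all_reals all_analysis.
From mathcomp Require Import measurable_realfun.
From mathcomp Require Import ring lra zify.

Import Order.TTheory GRing.Theory Num.Theory.
Import numFieldNormedType.Exports.

Local Open Scope classical_set_scope.
Local Open Scope ring_scope.

(** The density [sech_pdf] is even, so that of
    [|X + delta|] is x |-> sech_pdf (x - delta) + sech_pdf (x + delta) on
    (0, +oo).  A density is determined up to a null set, so a version that is
    continuous at a point has a prescribed value there: it suffices to sum the
    series and compare it with this explicit density.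

    Despite the central binomial coefficients, the series is geometric: those
    in the weights cancel against those in the mixed densities
    ([mix_term_geometric]).  With s = e^x - e^-x, c = e^x + e^-x and
    D = e^(2x) + e^(-2x), the ratio is (1 - theta) s^2 / D, and since
    D = s^2 + 2 the sum is theta^(1/2) 2^(3/2) c / (pi (2 + theta s^2))
    ([cvg_mix_series]).  For theta = 2 / h^2 with h = e^delta + e^-delta this
    is 2 h c / (pi (s^2 + h^2)).  On the other side, adding the two fractions
    in sech_pdf (x - delta) + sech_pdf (x + delta) gives the numerator h c and
    the denominator
    (e^(x-delta) + e^(delta-x)) (e^(x+delta) + e^(-x-delta)) = s^2 + h^2
    ([folded_sech_pdfE]), hence the same value.

    On the probabilistic side, the density of [|X + delta|] comes from the
    invariance of Lebesgue measure under translations and the reflection at 0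
    ([has_density_shift], [has_density_abs]), and the pointwise uniqueness is
    [has_density_eq]. *)

(** * Lebesgue integrals under measure-preserving maps *)

Lemma lebesgue_measure_shift (R : realType) (c : R) (A : set R) :
  measurable A ->
  pushforward lebesgue_measure (+%R^~ c : R -> measurableTypeR R) A =
  lebesgue_measure A.
Proof.
move=> mA.
apply/esym; apply: (@lebesgue_measure_unique _
  (pushforward lebesgue_measure (+%R^~ c : R -> measurableTypeR R))) => //=.
  by move=> ?; exact: measurable_funD.
move=> _ _ [[a b]] _ <-.
rewrite /pushforward/=.
have -> : (+%R^~ c) @^-1` `]a, b]%classic = `]a - c, b - c]%classic.
  by apply/seteqP; split=> x /=; rewrite !in_itv/= ltrBlDr lerBrDr.
by rewrite !lebesgue_measure_itv/= !lte_fin ltrD2r -!EFinD opprB addrA subrK.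
Qed.

Lemma ge0_integral_lebesgue_preserving {R : realType}
    (phi : R -> measurableTypeR R) (A : set R) (f : R -> R) :
  measurable_fun [set: R] phi ->
  (forall B : set R, measurable B ->
     pushforward lebesgue_measure phi B = lebesgue_measure B) ->
  measurable A -> measurable_fun [set: R] f -> (forall x, 0 <= f x) ->
  (\int[lebesgue_measure]_(x in A) (f x)%:E =
   \int[lebesgue_measure]_(x in phi @^-1` A) (f (phi x))%:E)%E.
Proof.
move=> mphi muphi mA mf f0.
rewrite -(@ge0_integral_pushforward _ _ (measurableTypeR R) _ _ phi mphi
  lebesgue_measure _ (EFin \o f))//=.
- by apply: eq_measure_integral => B mB _; exact/esym/muphi.
- by apply/measurable_EFinP; exact: measurable_funTS.
- by move=> x _; rewrite lee_fin.
Qed.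

(** * Densities of shifts and absolute values, and their uniqueness *)

Lemma has_density_shift {d} {T : measurableType d} {R : realType}
    {P : probability T R} {Y : T -> R} {f : R -> R} (c : R) :
  has_density P Y f -> has_density P (fun t => Y t + c) (fun x => f (x - c)).
Proof.
move=> [mf f0 PY].
have mfc : measurable_fun [set: R] (fun x => f (x - c)).
  apply: measurableT_comp => //; exact: measurable_funB.
split=> [//|//|A mA].
have mAc : measurable (+%R^~ c @^-1` A).
  rewrite -[X in measurable X]setTI.
  have : measurable_fun [set: R] (+%R^~ c) by exact: measurable_funD.
  exact.
rewrite (ge0_integral_lebesgue_preserving (+%R^~ c))//; first last.
- by move=> B; exact: lebesgue_measure_shift.
- exact: measurable_funD.
rewrite -[LHS]/(P (Y @^-1` (+%R^~ c @^-1` A))).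
by rewrite PY//; apply: eq_integral => x _; rewrite addrK.
Qed.

(** A value x > 0 of the absolute value comes from x and from - x, and the
    reflection at 0 preserves Lebesgue measure; the value 0, which comes from a
    single point, is negligible. *)
Lemma has_density_abs {d} {T : measurableType d} {R : realType}
    {P : probability T R} {Y : T -> R} {f : R -> R} :
  has_density P Y f ->
  has_density P (fun t => `|Y t|)
    (fun x => if 0 < x then f x + f (- x) else 0).
Proof.
move=> [mf f0 PY].
have mfN : measurable_fun [set: R] (fun x => f (- x)).
  exact: measurableT_comp.
split=> [|x|A mA].
- apply: measurable_fun_ifT => //; last exact: measurable_funD.
  exact: measurable_fun_ltr.
- by case: ifP => // _; rewrite addr_ge0.
have mabs : measurable (Num.norm @^-1` A : set R).
  rewrite -[X in measurable X]setTI.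
  by have : measurable_fun [set: R] Num.norm by []; exact.
pose A0 := A `&` `]0, +oo[%classic.
have mA0 : measurable A0 by apply: measurableI.
have mNA0 : measurable (-%R @^-1` A0 : set R).
  rewrite -[X in measurable X]setTI.
  by have : measurable_fun [set: R] -%R by []; exact.
have split0 : Num.norm @^-1` A `\` [set 0] = A0 `|` (-%R @^-1` A0).
  apply/seteqP; split=> x /=; rewrite /A0/= !in_itv/= !andbT oppr_gt0.
    move=> [Ax x0]; have [xlt|xgt|/x0//] := ltgtP x 0.
      by right; rewrite -ltr0_norm.
    by left; rewrite -(gtr0_norm xgt).
  move=> [] [Ax x0]; (split; last by move=> xE; rewrite xE ltxx in x0).
    by rewrite gtr0_norm.
  by rewrite ltr0_norm.
transitivity (P (Y @^-1` (Num.norm @^-1` A))); [by []|rewrite PY//].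
rewrite (@ge0_negligible_integral _ (measurableTypeR R) _ _ _ [set (0 : R)])//=;
  first last.
- exact: lebesgue_measure_set1.
- by move=> x _; rewrite lee_fin.
- by apply/measurable_EFinP; exact: measurable_funTS.
rewrite split0 ge0_integral_setU//=; first last.
- rewrite disj_set2E; apply/eqP; rewrite -subset0 => x [] [_ +] [_].
  by rewrite /= !in_itv/= !andbT oppr_gt0 => /lt_trans /[apply]; rewrite ltxx.
- by move=> x _; rewrite lee_fin.
- by apply/measurable_EFinP; exact: measurable_funTS.
have -> : (\int[lebesgue_measure]_(x in -%R @^-1` A0) (f x)%:E =
           \int[lebesgue_measure]_(x in A0) (f (- x))%:E)%E.
  rewrite [RHS](ge0_integral_lebesgue_preserving -%R)//; last first.
    by move=> B; exact: lebesgue_measureN.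
  by apply: eq_integral => x _; rewrite opprK.
rewrite -ge0_integralD//; first last.
- by apply/measurable_EFinP; exact: measurable_funTS.
- by move=> x _; rewrite lee_fin.
- by apply/measurable_EFinP; exact: measurable_funTS.
- by move=> x _; rewrite lee_fin.
rewrite integral_mkcondr; apply: eq_integral => x _.
by rewrite patchE mem_setE in_itv/= andbT; case: ifP.
Qed.

(** Two densities agree almost everywhere.  If they differed at a common
    continuity point, they would differ on a ball around it, which is not
    negligible. *)
Lemma has_density_eq {d} {T : measurableType d} {R : realType}
    {P : probability T R} {Y : T -> R} {f g : R -> R} {x : R} :
  has_density P Y f -> has_density P Y g ->
  {for x, continuous f} -> {for x, continuous g} -> f x = g x.
Proof.
move=> [mf f0 Pf] [mg g0 Pg] cf cg.
have fi : (@lebesgue_measure R).-integrable [set: R] (EFin \o f).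
  apply/integrableP; split; first exact/measurable_EFinP.
  under eq_integral => y _ do rewrite /= ger0_norm//.
  by rewrite -Pf// preimage_setT probability_setT ltry.
have [||N [mN N0 sN]] := @integral_ae_eq _ _ _ lebesgue_measure _ measurableT
    (EFin \o g) (EFin \o f) fi.
- exact/measurable_EFinP.
- by move=> E _ mE; rewrite -Pf// -Pg.
apply/eqP; apply: contrapT => /negP fgx.
have : \forall y \near x, f y - g y != 0.
  by apply: (cvgr_neq0 _ (cvgB cf cg)); rewrite subr_eq0.
move=> /nbhs_ballP[e /= e0 fge].
have beN : ball x e `<=` N.
  move=> y xy; apply: sN => /= /(_ I) [fg]; move: (fge _ xy).
  by rewrite fg subrr eqxx.
have : (lebesgue_measure (ball x e) <= 0 :> \bar R)%E.
  rewrite -N0; apply: le_measure => //; rewrite inE//.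
  exact: measurable_ball.
by rewrite (lebesgue_measure_ball _ (ltW e0)) lee_fin leNgt pmulrn_lgt0// e0.
Qed.

(** * The folded hyperbolic secant density *)

Lemma sech_pdfN (R : realType) (x : R) : sech_pdf (- x) = sech_pdf x.
Proof. by rewrite /sech_pdf opprK [expR (- x) + _]addrC. Qed.

Lemma continuous_sech_pdf (R : realType) : continuous (@sech_pdf R).
Proof.
move=> x; apply: cvgM; first exact: cvg_cst.
apply: cvgV.
  by rewrite gt_eqF// mulr_gt0 ?pi_gt0// addr_gt0 ?expR_gt0.
apply: cvgM; first exact: cvg_cst.
apply: cvgD; first exact: continuous_expR.
apply: continuous_comp; [exact: continuousN|exact: continuous_expR].
Qed.

Definition folded_sech_pdf {R : realType} (delta x : R) : R :=
  sech_pdf (x - delta) + sech_pdf (x + delta).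

Lemma continuous_folded_sech_pdf {R : realType} (delta : R) :
  continuous (folded_sech_pdf delta).
Proof.
move=> x; apply: cvgD.
- apply: (@continuous_comp _ _ _ (fun y : R => y - delta)); last first.
    exact: continuous_sech_pdf.
  by apply: cvgB; [exact: cvg_id|exact: cvg_cst].
- apply: (@continuous_comp _ _ _ (fun y : R => y + delta)); last first.
    exact: continuous_sech_pdf.
  by apply: cvgD; [exact: cvg_id|exact: cvg_cst].
Qed.

(** The two fractions brought to a common denominator: the product of their
    denominators is e^(2x) + e^(-2x) + e^(2 delta) + e^(-2 delta), that is
    (e^x - e^-x)^2 + (e^delta + e^-delta)^2. *)
Lemma folded_sech_pdfE (R : realType) (delta x : R) :
  folded_sech_pdf delta x =
  2 * (expR (- delta) + expR delta) * (expR x + expR (- x))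
  / (pi * ((expR x - expR (- x)) ^+ 2 + (expR (- delta) + expR delta) ^+ 2)).
Proof.
rewrite /folded_sech_pdf /sech_pdf !opprD !opprK !expRD !expRN.
(* [pi] is generalized because [field] would unfold its definition. *)
move: (expR delta) (expR_gt0 delta) (expR x) (expR_gt0 x) (pi : R) (pi_gt0 R).
move=> a a0 b b0 p p0.
have s2h : 0 < ((b * b - 1) * a) ^+ 2 + ((1 + a * a) * b) ^+ 2.
  by rewrite ltr_wpDl ?sqr_ge0// exprn_gt0// mulr_gt0// addr_gt0// mulr_gt0.
have ba1 : 0 < b * a * (b * a) + 1 by rewrite addr_gt0// !mulr_gt0.
have bbaa : 0 < b * b + a * a by rewrite addr_gt0// mulr_gt0.
by field; rewrite !gt_eqF.
Qed.

(** * Summation of the mixture series *)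

(** The binomial coefficient and the power 2^(2k) of the weight cancel against
    those of the mixed density, so only a k-th power remains. *)
Lemma mix_term_geometric (R : realType) (theta x : R) (k : nat) :
  mix_weight theta k * mix_density k x =
  theta `^ (1 / 2) * 2 `^ (3 / 2) / pi
    * ((expR x + expR (- x)) / (expR (2 * x) + expR (- (2 * x))))
  * ((1 - theta) * ((expR x - expR (- x)) ^+ 2
                    / (expR (2 * x) + expR (- (2 * x))))) ^+ k.
Proof.
have powE : 2 `^ ((2 * k)%:R + 3 / 2) = 2 ^+ (2 * k) * 2 `^ (3 / 2) :> R.
  by rewrite powRD ?powR_mulrn// pnatr_eq0 implybT.
have Cn0 : 'C(2 * k, k)%:R != 0 :> R by rewrite pnatr_eq0 -lt0n bin_gt0; lia.
have twon0 : 2 ^+ (2 * k) != 0 :> R by rewrite expf_neq0.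
have pin0 : (pi : R) != 0 by rewrite gt_eqF// pi_gt0.
rewrite /mix_weight /mix_density powE [in RHS]exprMn.
move: ('C(2 * k, k)%:R) (2 ^+ (2 * k)) (pi : R) Cn0 twon0 pin0.
move=> B N p Bn0 Nn0 pn0.
move: (theta `^ _) (2 `^ _) ((expR x + _) / _) ((1 - _) ^+ k) ((_ / _) ^+ k).
move=> u v w y z.
by field; rewrite Bn0 Nn0 pn0.
Qed.

(** Geometric series of ratio (1 - theta) s^2 / D, where s = e^x - e^-x and
    D = e^(2x) + e^(-2x) = s^2 + 2; the ratio lies in [0, 1) because s^2 < D,
    and D - (1 - theta) s^2 = 2 + theta s^2. *)
Lemma cvg_mix_series (R : realType) (theta x : R) :
  0 < theta <= 1 ->
  series (fun k => mix_weight theta k * mix_density k x) @ \oo -->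
    theta `^ (1 / 2) * 2 `^ (3 / 2) / pi * (expR x + expR (- x))
    / (2 + theta * (expR x - expR (- x)) ^+ 2).
Proof.
move=> /andP[theta0 theta1].
have s2 : (expR x - expR (- x)) ^+ 2 = expR (2 * x) + expR (- (2 * x)) - 2.
  rewrite mulr_natl mulr2n opprD !expRD !expRN.
  by field; rewrite gt_eqF ?expR_gt0.
have := addr_gt0 (expR_gt0 (2 * x)) (expR_gt0 (- (2 * x))).
under eq_fun do rewrite mix_term_geometric.
move: (expR (2 * x) + _) (expR x - _) s2 => D s s2 D0.
have Dn0 : D != 0 by rewrite gt_eqF.
pose t := s ^+ 2 / D.
have t0 : 0 <= t by rewrite divr_ge0 ?sqr_ge0// ltW.
have t1 : t < 1 by rewrite ltr_pdivrMr// mul1r s2 gtrBl.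
have q1 : `|(1 - theta) * t| < 1.
  have u0 : 0 <= 1 - theta by rewrite subr_ge0.
  rewrite ger0_norm; last exact: mulr_ge0.
  by apply: mulr_ilt1 => //; rewrite gtrBl.
have den : 2 + theta * s ^+ 2 != 0.
  by rewrite gt_eqF// ltr_wpDr// mulr_ge0 ?sqr_ge0// ltW.
have -> : theta `^ (1 / 2) * 2 `^ (3 / 2) / pi * (expR x + expR (- x))
    / (2 + theta * s ^+ 2) =
    theta `^ (1 / 2) * 2 `^ (3 / 2) / pi * ((expR x + expR (- x)) / D)
    * (1 - (1 - theta) * t)^-1.
  have -> : 1 - (1 - theta) * t = (2 + theta * s ^+ 2) / D.
    rewrite /t -[in LHS](divff Dn0) {1}(_ : D = s ^+ 2 + 2); first by field.
    by rewrite s2 subrK.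
  rewrite invf_div; move: (pi : R) (lt0r_neq0 (pi_gt0 R)) => p pn0.
  by field; rewrite Dn0 den pn0.
exact: cvg_geometric_series.
Qed.

(** The value (e^-delta + e^delta)^2 exceeds 4 by a square, so that
    [sech_theta] is in fact at most 1 / 2. *)
Lemma sech_theta_itv (R : realType) (delta : R) : 0 < sech_theta delta <= 1.
Proof.
have h0 : 0 < expR (- delta) + expR delta by rewrite addr_gt0 ?expR_gt0.
apply/andP; split; first by rewrite divr_gt0// exprn_gt0.
rewrite ler_pdivrMr ?exprn_gt0// mul1r.
have -> : (expR (- delta) + expR delta) ^+ 2 =
    (expR delta - expR (- delta)) ^+ 2 + 4.
  by rewrite expRN; field; rewrite gt_eqF ?expR_gt0.
by rewrite ler_wpDl ?sqr_ge0// ler_nat.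
Qed.

(** For this theta the factor theta^(1/2) 2^(3/2) is 4 / h with
    h = e^-delta + e^delta, and multiplying through by h^2 turns the sum of the
    mixture series into the closed form of the folded density. *)
Lemma cvg_mix_series_sech (R : realType) (delta x : R) :
  series (fun k => mix_weight (sech_theta delta) k * mix_density k x)
    @ \oo --> folded_sech_pdf delta x.
Proof.
have h0 : 0 < expR (- delta) + expR delta by rewrite addr_gt0 ?expR_gt0.
suff <- : sech_theta delta `^ (1 / 2) * 2 `^ (3 / 2) / pi
      * (expR x + expR (- x))
      / (2 + sech_theta delta * (expR x - expR (- x)) ^+ 2) =
    folded_sech_pdf delta x by exact/cvg_mix_series/sech_theta_itv.
rewrite folded_sech_pdfE.
have -> : sech_theta delta `^ (1 / 2) =
    2 `^ (1 / 2) / (expR (- delta) + expR delta).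
  rewrite /sech_theta powRM ?invr_ge0 ?exprn_ge0 ?ltW// !div1r; congr (_ * _).
  rewrite powR12_sqrt ?invr_ge0 ?exprn_ge0 ?ltW// -exprVn sqrtr_sqr.
  by rewrite ger0_norm// invr_ge0 ltW.
have -> : 2 `^ (1 / 2) / (expR (- delta) + expR delta) * 2 `^ (3 / 2) =
    4 / (expR (- delta) + expR delta) :> R.
  rewrite mulrAC -powRD; last by rewrite pnatr_eq0 implybT.
  by rewrite (_ : 1 / 2 + 3 / 2 = 2%:R); [rewrite powR_mulrn// -natrX|field].
rewrite /sech_theta.
move: (_ + expR delta) h0 (pi : R) (pi_gt0 R) (expR x - _) => h h0 p p0 s.
have hs : 0 < s ^+ 2 + h ^+ 2 by rewrite ltr_wpDl ?sqr_ge0// exprn_gt0.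
by field; rewrite !gt_eqF//; lra.
Qed.

(** * The mixture representation *)

Theorem theorem3 (R : realType) (d : measure_display) (T : measurableType d)
    (P : probability T R) (X : {RV P >-> R}) (delta : R)
    (hX : has_density P X (@sech_pdf R))
    (hdelta : delta != 0) :
  (exists fdelta : R -> R,
     has_density_continuous_gt0 P (fun t => `|X t + delta|) fdelta) /\
  (forall fdelta : R -> R,
     has_density_continuous_gt0 P (fun t => `|X t + delta|) fdelta ->
     forall x : R, 0 < x ->
       series (fun k => mix_weight (sech_theta delta) k * mix_density k x)
         @ \oo --> fdelta x).
Proof.
have hasf : has_density P (fun t => `|X t + delta|)
    (fun x => if 0 < x then folded_sech_pdf delta x else 0).
  have := has_density_abs (has_density_shift delta hX).
  congr has_density; apply/funext => x; case: ifP => // _.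
  by rewrite -[sech_pdf (- x - _)]sech_pdfN opprB opprK [delta + x]addrC.
have cf (x : R) : 0 < x ->
    {for x, continuous (fun y : R =>
       if 0 < y then folded_sech_pdf delta y else 0)}.
  move=> x0; rewrite /prop_for /continuous_at /= x0.
  apply: cvg_trans (continuous_folded_sech_pdf delta x).
  apply: near_eq_cvg; near=> y; rewrite ifT//; near: y; exact: lt_nbhsr.
split=> [|fd [fdP cfd] x x0].
  by eexists; split; [exact: hasf|exact: cf].
have := has_density_eq fdP hasf (cfd _ x0) (cf _ x0).
by rewrite x0 => ->; exact: cvg_mix_series_sech.
Unshelve. all: by end_near.
Qed.
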